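(* Let $q\in\widetilde{\mathbb C}$ and $\nu\in\mathbb C$ with $\nu\neq\frac{2-q}{q-1}$ and $\nu\neq-[n]_q-1$ for all $n\ge0$. Let $\mathcal B[\nu,q]$ be the symmetrical form such that $\sigma\mathcal B[\nu,q]=\mathbf B\big(\tfrac{\nu+1}{2},q\big)$. Then $\mathcal B[\nu,q]$ is $H_{\sqrt q}$-semiclassical of class one and satisfies $$H_{\sqrt q}\big(x^3\mathcal B[\nu,q]\big)-2(\sqrt q+1)\left(\frac{\nu+1}{2}x^2+1\right)\mathcal B[\nu,q]=0 .$$ With $\alpha=\frac{\nu+1}{2}$, its recurrence coefficients are $\gamma_1=-\frac1\alpha$ and, for $n\ge0$, $$\gamma_{2n+2}=2q^{2n}\frac{[n+1]_q}{(2\alpha+[2n]_q)(2\alpha+[2n+1]_q)},\qquad \gamma_{2n+3}=-2q^{n+1}\frac{2\alpha+[n]_q}{(2\alpha+[2n+1]_q)(2\alpha+[2n+2]_q)} .$$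
   Context: $\mathcal P$ is the vector space of polynomials in one variable with complex coefficients and $\mathcal P'$ its dual; elements of $\mathcal P'$ are called forms; $\langle u,f\rangle$ is the action of $u$ on $f$ and $(u)_n=\langle u,x^n\rangle$ are the moments. All regular forms are normalized by $(u)_0=1$. A form is symmetrical if $(u)_{2n+1}=0$ for all $n\ge0$. Let $\widetilde{\mathbb C}=\{z\in\mathbb C: z\neq0,\ z^n\neq1\ \forall n\ge1\}$; $\sqrt{\cdot}$ is the principal square root; $[n]_q=\frac{q^n-1}{q-1}$. For a polynomial $g$, $\langle gu,f\rangle=\langle u,gf\rangle$. For $r\in\widetilde{\mathbb C}$, $(H_rf)(x)=\frac{f(rx)-f(x)}{(r-1)x}$ and $\langle H_ru,f\rangle=-\langle u,H_rf\rangle$. The form $\sigma u$ is defined by $\langle\sigma u,f\rangle=\langle u,f(x^2)\rangle$. A form $u$ is regular if there is a sequence of monic polynomials $\{B_n\}_{n\ge0}$, $\deg B_n=n$, with $\langle u,B_mB_n\rangle=r_n\delta_{n,m}$, $r_n\ne0$; then $B_0=1$, $B_1=x-\beta_0$, $B_{n+2}=(x-\beta_{n+1})B_{n+1}-\gamma_{n+1}B_n$ with $\gamma_{n+1}\neq0$, $n\ge0$ (for symmetrical $u$ all $\beta_n=0$); the $\gamma_{n+1}$ are the recurrence coefficients. A form $u$ is $H_r$-semiclassical if it is regular and $H_r(\Phi u)+\Psi u=0$ for some polynomials $\Phi$ (monic, degree $t\ge0$) and $\Psi$ (degree $p\ge1$). It is of class $s=\max(p-1,t-2)$ if the pair $(\Phi,\Psi)$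 satisfies $$\prod_{c\in\mathcal Z_\Phi}\Big\{\big|r\Psi(rc)+(H_r\Phi)(c)\big|+\big|\langle u,\ r(\theta_{cr}\Psi)+\theta_{cr}(\theta_c\Phi)\rangle\big|\Big\}>0,$$ where $\mathcal Z_\Phi$ is the set of zeros of $\Phi$ and $(\theta_cf)(x)=\frac{f(x)-f(c)}{x-c}$. $\mathbf B(\alpha,q)$ (the $q$-analogue of the Bessel form), for $\alpha\ne\frac12(q-1)^{-1}$, $\alpha\neq-\frac12[n]_q$, $n\ge0$, is the form with $(\mathbf B(\alpha,q))_0=1$ satisfying $H_q(x^2\mathbf B(\alpha,q))-2(\alpha x+1)\mathbf B(\alpha,q)=0$. *)

(* Defs.v *)
From HB Require Import structures.
From mathcomp Require Import all_boot all_order all_algebra.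
From mathcomp Require Import boolp classical_sets fsbigop reals complex.
From mathcomp Require Import ring.

Set Implicit Arguments.
Unset Strict Implicit.
Unset Printing Implicit Defensive.

Import Order.TTheory GRing.Theory Num.Theory.
Local Open Scope classical_set_scope.
Local Open Scope ring_scope.

Section Forms.
Variable C : numClosedFieldType.

Implicit Types (r q c alpha : C) (f g Phi Psi : {poly C}).

Definition Ctilde r : Prop :=
  r != 0 /\ forall n, (1 <= n)%N -> r ^+ n != 1.

Definition qbracket q n : C := (q ^+ n - 1) / (q - 1).

(* The divisions in H_op and theta are exact (for r outside {0, 1}). *)
Definition H_op r f : {poly C} :=
  (f \Po (r *: 'X) - f) %/ ((r - 1) *: 'X).

Definition theta c f : {poly C} := (f - f.[c]%:P) %/ ('X - c%:P).

Fact H_op_is_linear r : linear (H_op r).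
Proof.
move=> a f g; rewrite /H_op -divpZl -divpD; congr (_ %/ _).
by rewrite linearP scalerBr opprD addrACA.
Qed.
HB.instance Definition _ r :=
  GRing.isLinear.Build C {poly C} {poly C} *:%R (H_op r) (H_op_is_linear r).

Local Notation form := {scalar {poly C}}.
Implicit Types u v : form.

Definition moment u n : C := u 'X^n.

Definition poly_mul_form g u : {poly C} -> C := fun f => u (g * f).

Fact poly_mul_form_is_scalar g u : scalar (poly_mul_form g u).
Proof. by move=> a f h; rewrite /poly_mul_form mulrDr -scalerAr linearP. Qed.
HB.instance Definition _ g u :=
  GRing.isLinear.Build C {poly C} C *%R (poly_mul_form g u)
    (poly_mul_form_is_scalar g u).

Definition H_form r u : {poly C} -> C := fun f => - u (H_op r f).

Fact H_form_is_scalar r u : scalar (H_form r u).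
Proof. by move=> a f g; rewrite /H_form !linearP /= opprD mulrN. Qed.
HB.instance Definition _ r u :=
  GRing.isLinear.Build C {poly C} C *%R (H_form r u) (H_form_is_scalar r u).

Definition sigma_form u : {poly C} -> C := fun f => u (f \Po 'X^2).

Fact sigma_form_is_scalar u : scalar (sigma_form u).
Proof. by move=> a f g; rewrite /sigma_form !linearP. Qed.
HB.instance Definition _ u :=
  GRing.isLinear.Build C {poly C} C *%R (sigma_form u) (sigma_form_is_scalar u).

Definition symmetrical u : Prop := forall n, moment u n.*2.+1 = 0.

(* H_r (Phi u) + Psi u = 0, as an identity between linear forms *)
Definition H_equation r Phi Psi u : Prop :=
  forall f, H_form r (poly_mul_form Phi u) f + poly_mul_form Psi u f = 0.

Definition monic_OPS u (B : nat -> {poly C}) : Prop :=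
  (forall n, B n \is monic /\ size (B n) = n.+1) /\
  exists rho : nat -> C, (forall n, rho n != 0) /\
    forall m n, u (B m * B n) = (if n == m then rho n else 0).

(* Regular forms are normalized by (u)_0 = 1. *)
Definition regular u : Prop := moment u 0 = 1 /\ exists B, monic_OPS u B.

(* gamma is used from index 1 on; gamma 0 plays no role. *)
Definition recurrence_coefficients u (beta gamma : nat -> C) : Prop :=
  exists B, [/\ monic_OPS u B, B 0%N = 1, B 1%N = 'X - (beta 0%N)%:P,
    (forall n, B n.+2 = ('X - (beta n.+1)%:P) * B n.+1 - gamma n.+1 *: B n)
    & forall n, gamma n.+1 != 0].

Definition semiclassical_pair r u Phi Psi : Prop :=
  [/\ Phi \is monic, (2 <= size Psi)%N & H_equation r Phi Psi u].

(* A finite product over the zeros of Phi when Phi != 0; the empty product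
   is 1, so the condition is void for constant Phi. *)
Definition class_condition r u Phi Psi : Prop :=
  0 < \big[*%R/1]_(c \in [set c | root Phi c])
        (`|r * Psi.[r * c] + (H_op r Phi).[c]|
         + `|u (r *: theta (c * r) Psi + theta (c * r) (theta c Phi))|).

(* size is degree plus one, so (size Psi).-2 is p - 1 and size Phi - 3 is
   t - 2; truncating t - 2 at 0 does not change the maximum since p >= 1. *)
Definition semiclassical_of_class r u (s : nat) : Prop :=
  [/\ Ctilde r, regular u &
    exists Phi Psi, [/\ semiclassical_pair r u Phi Psi,
      class_condition r u Phi Psi
      & s = maxn (size Psi).-2 (size Phi - 3)]].

(* Given q in Ctilde, these conditions determine u uniquely as soon as
   alpha != - [n]_q / 2 for all n: see is_qBessel_moment, and
   symmetrized_qBessel_exists and symmetrized_qBessel_unique for the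
   symmetrized form. *)
Definition is_qBessel alpha q u : Prop :=
  moment u 0 = 1 /\
  H_equation q 'X^2 (- (2 *: (alpha *: 'X + 1))) u.

Definition is_symmetrized_qBessel nu q v : Prop :=
  symmetrical v /\
  exists u, is_qBessel ((nu + 1) / 2) q u /\ sigma_form v =1 u.

Lemma eq_form_moment u v : (forall n, moment u n = moment v n) -> u =1 v.
Proof.
move=> uv f; rewrite -[f]coefK poly_def !raddf_sum.
by apply: eq_bigr => i _ /=; rewrite !scalarZ; congr (_ * _); exact: uv.
Qed.

Lemma moment_form_exists (m : nat -> C) : exists u, moment u =1 m.
Proof.
pose F N f : C := \sum_(i < N) f`_i * m i.
have FE N f : (size f <= N)%N -> F (size f) f = F N f.
  move=> leN; rewrite /F (big_ord_widen N (fun i => f`_i * m i) leN).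
  rewrite big_mkcond; apply: eq_bigr => i _; case: ltnP => // fi.
  by rewrite nth_default ?mul0r.
pose U f := F (size f) f.
have Ulin : scalar U.
  move=> a f g; pose N := maxn (size (a *: f + g)) (maxn (size f) (size g)).
  rewrite /U !(FE N) ?leq_max ?leqnn ?orbT // /F mulr_sumr -big_split /=.
  by apply: eq_bigr => i _; rewrite coefD coefZ mulrDl mulrA.
pose L := GRing.isLinear.Build C {poly C} C *%R U Ulin.
pose u : form := HB.pack U L.
exists u => n; rewrite /moment /= /U /F size_polyXn big_ord_recr /= big1.
  by rewrite add0r coefXn eqxx mul1r.
by move=> i _; rewrite coefXn ltn_eqF ?mul0r.
Qed.

Lemma H_opXn r n : r != 1 -> H_op r 'X^n = qbracket r n *: 'X^(n.-1).
Proof.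
move=> r1; have r1' : r - 1 != 0 by rewrite subr_eq0.
rewrite /H_op /qbracket comp_Xn_poly exprZn -[X in _ - X]scale1r -scalerBl.
case: n => [|n]; first by rewrite expr0 subrr scale0r div0p mul0r scale0r.
by rewrite divpZl divpZr // scalerA (exprSr 'X n) mulpK ?polyX_eq0.
Qed.

Lemma is_qBessel_moment alpha q u : q != 1 ->
  is_qBessel alpha q u <->
  moment u 0 = 1 /\ forall n,
    (2 * alpha + qbracket q n) * moment u n.+1 = - (2 * moment u n).
Proof.
move=> q1; rewrite /is_qBessel.
set Psi := - _; have key n : H_form q (poly_mul_form 'X^2 u) 'X^n
    + poly_mul_form Psi u 'X^n =
    - ((2 * alpha + qbracket q n) * moment u n.+1 + 2 * moment u n).
  rewrite /H_form /= /poly_mul_form H_opXn // -scalerAr scalarZ.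
  have -> : qbracket q n * u ('X^2 * 'X^(n.-1)) = qbracket q n * moment u n.+1.
    case: n => [|n]; first by rewrite /qbracket expr0 subrr mul0r !mul0r.
    by rewrite -exprD.
  rewrite /Psi mulNr -scalerAl mulrDl mul1r -scalerAl -exprS raddfN /= !scalarZ.
  rewrite raddfD /= scalarZ -!/(moment _ _).
  by rewrite /moment; ring.
split=> -[u0 eqn]; split=> //.
  by move=> n; apply/eqP; rewrite -addr_eq0 -oppr_eq0 -key eqn.
move=> f; rewrite -[f]coefK poly_def !raddf_sum -big_split big1 //= => i _.
by rewrite !scalarZ -mulrDr key eqn addNr oppr0 mulr0.
Qed.

Section SymmetrizedExistence.
Variables nu q : C.
Hypothesis q1 : q != 1.
Hypothesis hnu : forall n, nu != - qbracket q n - 1.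

Let coef_neq0 n : 2 * ((nu + 1) / 2) + qbracket q n != 0.
Proof.
rewrite mulrC divfK ?pnatr_eq0 //; apply: contraNneq (hnu n) => e.
by rewrite -subr_eq0 -e; apply/eqP; ring.
Qed.

Lemma symmetrized_qBessel_exists : exists v, is_symmetrized_qBessel nu q v.
Proof.
pose m := fix m n : C := if n is k.+1 then
  - (2 * m k) / (2 * ((nu + 1) / 2) + qbracket q k) else 1.
have [u um] := moment_form_exists m.
have [v vm] := moment_form_exists (fun n => if odd n then 0 else m n./2).
exists v; split; first by move=> n; rewrite vm /= odd_double.
exists u; split.
  apply/is_qBessel_moment => //; split=> [|n]; rewrite !um //=.
  by rewrite mulrC divfK ?coef_neq0.
apply: (@eq_form_moment (sigma_form v) u) => n.
rewrite um {1}/moment /= /sigma_form comp_Xn_poly -exprM -/(moment v _) vm.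
by rewrite mul2n odd_double doubleK.
Qed.

Lemma symmetrized_qBessel_unique v w :
  is_symmetrized_qBessel nu q v -> is_symmetrized_qBessel nu q w -> v =1 w.
Proof.
move=> [sv [b [/is_qBessel_moment-/(_ q1)[b0 bS] vb]]].
move=> [sw [d [/is_qBessel_moment-/(_ q1)[d0 dS] wd]]].
have bd n : moment b n = moment d n.
  elim: n => [|n IHn]; first by rewrite b0 d0.
  by apply: (mulfI (coef_neq0 n)); rewrite bS dS IHn.
apply: eq_form_moment => n; rewrite -[n]odd_double_half.
case: (odd n); first by rewrite add1n sv sw.
have even z : moment z n./2.*2 = sigma_form z 'X^(n./2).
  by rewrite /moment /sigma_form comp_Xn_poly -exprM mul2n.
by rewrite add0n !even vb wd; exact: bd.
Qed.

End SymmetrizedExistence.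

End Forms.

(* Main.v *)
Require Import Defs.
From mathcomp Require Import all_boot all_order all_algebra.
From mathcomp Require Import reals complex.
From mathcomp Require Import classical_sets fsbigop.
From mathcomp Require Import ring.

Import Order.TTheory GRing.Theory Num.Theory.
Local Open Scope ring_scope.

(** The even moments of the form satisfy a first-order recurrence, and the
    whole theorem is read off from it.  Write [a] for twice alpha and
    [d n = a + [n]_q]; the condition that nu is never [- [n]_q - 1] says that
    no [d n] vanishes, and the definition of the q-Bessel form says that the
    even moments [u_n] satisfy [d n * u_(n+1) = - 2 u_n].

    The functional equation is this same recurrence, tested on monomials and
    multiplied by [sqrt q + 1], because [[2n]] in base [sqrt q] is
    [(sqrt q + 1) [n]_q].  The class condition involves only the zero of
    [x^3], where it is the nonvanishing of [- 2 sqrt q (sqrt q + 1)].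

    For the recurrence coefficients, let the polynomials be generated by the
    claimed [gamma].  Orthogonality does not require their coefficients: the
    value of the form at [x^M] times the polynomial of index [N] vanishes by
    symmetry for [M + N] odd, and has a closed product form otherwise
    ([mixed_moments]).  With [k] and [n] the integer parts of [M / 2] and
    [N / 2], it is proportional to the product of the [[k]_q - [j]_q] over
    [j < n], which vanishes for [k < n] and not for [k = n]: this is
    orthogonality.  The closed form propagates along the three-term recurrence
    thanks to two identities between q-brackets, [qbracketD] and
    [qbracket_exchange]. *)

Set Implicit Arguments.
Unset Strict Implicit.
Unset Printing Implicit Defensive.

(** * Orthogonality from mixed moments *)

Section Orthogonality.
Variable C : numClosedFieldType.
Implicit Types (v : {scalar {poly C}}) (g : nat -> C).

(** It is enough to test each polynomial against the monomials of smaller and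
    equal degree, because a monic polynomial is its leading monomial plus
    lower ones. *)
Lemma monic_OPS_of_mixed_moments v (B : nat -> {poly C}) :
    (forall n, B n \is monic /\ size (B n) = n.+1) ->
    (forall m n, (m < n)%N -> v ('X^m * B n) = 0) ->
    (forall n, v ('X^n * B n) != 0) ->
  monic_OPS v B.
Proof.
move=> Bmon B0 Bn; split=> //; exists (fun n => v ('X^n * B n)); split=> //.
have expand m n : v (B m * B n) = \sum_(i < m.+1) (B m)`_i * v ('X^i * B n).
  rewrite -{1}[B m]coefK poly_def (Bmon m).2 mulr_suml raddf_sum.
  by apply: eq_bigr => i _ /=; rewrite -scalerAl scalarZ.
have lt0 m n : (m < n)%N -> v (B m * B n) = 0.
  move=> mn; rewrite expand big1 // => i _.
  by rewrite B0 ?mulr0 // (leq_trans (ltn_ord i)).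
move=> m n; case: (ltngtP n m) => [nm|mn|->].
- by rewrite mulrC lt0.
- by rewrite lt0.
- rewrite expand big_ord_recr /= big1 ?add0r.
    have /monicP := (Bmon m).1; rewrite /lead_coef (Bmon m).2 /= => ->.
    by rewrite mul1r.
  by move=> i _; rewrite B0 ?mulr0.
Qed.

(* The pair carries two consecutive polynomials, as the recursion needs. *)
Fixpoint sym_poly_pair g n : {poly C} * {poly C} :=
  if n is m.+1 then
    let: (p, p1) := sym_poly_pair g m in (p1, 'X * p1 - g m.+1 *: p)
  else (1, 'X).

Definition sym_poly g n := (sym_poly_pair g n).1.

Lemma sym_polySS g n :
  sym_poly g n.+2 = 'X * sym_poly g n.+1 - g n.+1 *: sym_poly g n.
Proof. by rewrite /sym_poly /=; case: (sym_poly_pair g n). Qed.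

Lemma sym_poly_monic g n :
  sym_poly g n \is monic /\ size (sym_poly g n) = n.+1.
Proof.
suff: (sym_poly g n \is monic /\ size (sym_poly g n) = n.+1) /\
    (sym_poly g n.+1 \is monic /\ size (sym_poly g n.+1) = n.+2) by case.
elim: n => [|n [IH1 [m2 s2]]].
  by rewrite /sym_poly /= monicX size_polyX monic1 size_poly1.
split=> //; rewrite sym_polySS.
have sX : size ('X * sym_poly g n.+1) = n.+3.
  by rewrite mulrC size_mulX ?monic_neq0 // s2.
have lt : (size (- (g n.+1 *: sym_poly g n))%R
           < size ('X * sym_poly g n.+1)%R)%N.
  rewrite size_polyN sX; apply: (leq_ltn_trans (size_scale_leq _ _)).
  by rewrite IH1.2.
rewrite size_polyDl // sX; split=> //.
by rewrite monicE lead_coefDl // -monicE monicMl ?monicX.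
Qed.

Lemma mixed_moment_rec g v m n :
  v ('X^m * sym_poly g n.+2) =
  v ('X^(m.+1) * sym_poly g n.+1) - g n.+1 * v ('X^m * sym_poly g n).
Proof.
by rewrite sym_polySS mulrBr mulrA -exprSr raddfB /= -scalerAr scalarZ.
Qed.

Lemma mixed_moment_odd g v m n : symmetrical v ->
  odd (m + n) -> v ('X^m * sym_poly g n) = 0.
Proof.
move=> sv; have v0 k : odd k -> v 'X^k = 0.
  by move=> ok; rewrite -[k]odd_double_half ok add1n; exact: sv.
suff: forall m, (odd (m + n) -> v ('X^m * sym_poly g n) = 0) /\
    (odd (m + n.+1) -> v ('X^m * sym_poly g n.+1) = 0) by move=> /(_ m) [].
elim: n {m} => [|n IH] m.
  rewrite /sym_poly /= mulr1 -exprSr addn0 addn1; split; exact: v0.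
split; first exact: (IH m).2.
move=> o; rewrite mixed_moment_rec (IH m.+1).2 ?(IH m).1 ?mulr0 ?subrr //.
  by move: o; rewrite !addnS /= negbK.
by move: o; rewrite addSnnS.
Qed.

Lemma recurrence_coefficients_sym_poly g v :
    (forall n, g n.+1 != 0) -> monic_OPS v (sym_poly g) ->
  recurrence_coefficients v (fun=> 0) g.
Proof.
move=> g0 ops; exists (sym_poly g).
split=> //; first by rewrite /sym_poly /= subr0.
by move=> n; rewrite sym_polySS subr0.
Qed.

End Orthogonality.

(** * Identities between q-brackets *)

Section Brackets.
Variables (C : numClosedFieldType) (q : C).
Hypothesis hq : Ctilde q.

Lemma Ctilde_neq0 : q != 0. Proof. by case: hq. Qed.

Lemma Ctilde_neq1 : q != 1.
Proof. by case: hq => _ /(_ 1%N isT); rewrite expr1. Qed.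

Lemma Ctilde_subr1 : q - 1 != 0.
Proof. by rewrite subr_eq0 Ctilde_neq1. Qed.

Lemma qbracket0 : qbracket q 0 = 0.
Proof. by rewrite /qbracket expr0 subrr mul0r. Qed.

Lemma qbracketS n : qbracket q n.+1 = q * qbracket q n + 1.
Proof. by rewrite /qbracket exprS; field; exact: Ctilde_subr1. Qed.

Lemma qbracketD k n :
  qbracket q (k + n) - qbracket q (n + n) =
  q ^+ n * (qbracket q k - qbracket q n).
Proof. by rewrite /qbracket !exprD; field; exact: Ctilde_subr1. Qed.

Lemma qbracket_neq j k : (j < k)%N -> qbracket q k - qbracket q j != 0.
Proof.
move=> jk; have -> : qbracket q k - qbracket q j
    = q ^+ j * ((q ^+ (k - j) - 1) / (q - 1)).
  rewrite /qbracket -{1}(subnK (ltnW jk)) exprD.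
  by field; exact: Ctilde_subr1.
rewrite !mulf_neq0 ?invr_eq0 ?expf_neq0 ?Ctilde_neq0 ?Ctilde_subr1 //.
by rewrite subr_eq0; apply: hq.2; rewrite subn_gt0.
Qed.

(** The right-hand side vanishes at [k = n]; the factor so extracted is the
    one that extends [bracket_prod n k] to [bracket_prod n.+1 k] in the odd
    step of [mixed_moments]. *)
Lemma qbracket_exchange (a : C) k n :
  q * (a + qbracket q n) * (qbracket q k - qbracket q n) =
  qbracket q k.+1 * (a + qbracket q (2 * n + 1))
  - qbracket q n.+1 * (a + qbracket q (k + n).+1).
Proof.
rewrite /qbracket mul2n -addnn addn1 !exprS !exprD.
by field; exact: Ctilde_subr1.
Qed.

Definition bracket_prod n k : C := \prod_(j < n) (qbracket q k - qbracket q j).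

Lemma bracket_prodS n k :
  bracket_prod n.+1 k = bracket_prod n k * (qbracket q k - qbracket q n).
Proof. by rewrite /bracket_prod big_ord_recr. Qed.

Lemma bracket_prodSS n k :
  bracket_prod n.+1 k.+1 = q ^+ n * qbracket q k.+1 * bracket_prod n k.
Proof.
rewrite /bracket_prod big_ord_recl qbracket0 subr0.
under eq_bigr => j _ do
  rewrite /= !qbracketS opprD addrACA subrr addr0 -mulrBr.
by rewrite big_split /= prodr_const card_ord mulrCA mulrA.
Qed.

Lemma bracket_prod_lt n k : (k < n)%N -> bracket_prod n k = 0.
Proof.
move=> kn; rewrite /bracket_prod (bigD1 (Ordinal kn)) //=.
by rewrite subrr mul0r.
Qed.

Lemma bracket_prod_neq0 n : bracket_prod n n != 0.
Proof. by apply/prodf_neq0 => j _; apply: qbracket_neq. Qed.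

End Brackets.

(** * Recurrence coefficients of the symmetrized form *)

Section Coefficients.
Variables (C : numClosedFieldType) (q a : C) (v : {scalar {poly C}}).
Hypothesis hq : Ctilde q.

Let d n := a + qbracket q n.
Hypothesis d_neq0 : forall n, a + qbracket q n != 0.

Definition qB_gamma n : C :=
  match n with
  | 0 => 0
  | 1 => - 2 / a
  | m.+2 => let k := m./2 in
    if odd m then
      - 2 * q ^+ k.+1 * ((a + qbracket q k) /
        ((a + qbracket q (2 * k + 1)) * (a + qbracket q (2 * k + 2))))
    else
      2 * q ^+ (2 * k) * (qbracket q k.+1 /
        ((a + qbracket q (2 * k)) * (a + qbracket q (2 * k + 1))))
  end.

Local Notation g := qB_gamma.

Lemma qB_gamma_even n : g (2 * n + 2) =
  2 * q ^+ (2 * n) * (qbracket q n.+1 / (d (2 * n) * d (2 * n + 1))).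
Proof. have [o h] : odd (2 * n) = false /\ (2 * n)./2 = n.
  by rewrite mul2n odd_double doubleK.
by rewrite addn2 /g o h. Qed.

Lemma qB_gamma_odd n : g (2 * n + 3) =
  - 2 * q ^+ n.+1 * (d n / (d (2 * n + 1) * d (2 * n + 2))).
Proof.
have [o h] : odd (2 * n).+1 /\ (2 * n).+1./2 = n.
  by rewrite mul2n /= odd_double uphalf_double.
by rewrite addn3 /g o h.
Qed.

Let a_neq0 : a != 0.
Proof. by have := d_neq0 0; rewrite qbracket0 addr0. Qed.

Lemma qB_gamma_neq0 n : g n.+1 != 0.
Proof.
have q0 := Ctilde_neq0 hq; have two : (2 : C) != 0 by rewrite pnatr_eq0.
have q10 := Ctilde_subr1 hq.
have q1 k : q ^+ k.+1 - 1 != 0 by rewrite subr_eq0; apply: hq.2.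
case: n => [|n]; first by rewrite mulf_neq0 ?oppr_eq0 ?invr_eq0.
rewrite /g; case: ifP => _;
  by rewrite !mulf_neq0 ?oppr_eq0 ?expf_neq0 ?invr_eq0 ?mulf_neq0.
Qed.

Hypothesis v_sym : symmetrical v.
Hypothesis v0 : moment v 0 = 1.
Hypothesis v_rec : forall n,
  (a + qbracket q n) * moment v n.+1.*2 = - (2 * moment v n.*2).

Let u n := moment v n.*2.

Let u_step n : u n = - (d n / 2) * u n.+1.
Proof.
have two : (2 : C) != 0 by rewrite pnatr_eq0.
apply: (mulfI two); apply: oppr_inj; rewrite -v_rec /u /d.
by field.
Qed.

Lemma even_moment_neq0 n : moment v n.*2 != 0.
Proof.
elim: n => [|n IH]; first by rewrite double0 v0 oner_eq0.
by apply: contraNneq IH => e; rewrite -/(u n) u_step /u e mulr0.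
Qed.

(** The part of the closed form that does not depend on the exponent: each
    passage from index [2i] to [2i+2] contributes one factor. *)
Definition mixed_coef n : C := \prod_(i < n) (g (2 * i + 1) * q ^+ i / 2).

Lemma mixed_coefS n :
  mixed_coef n.+1 = mixed_coef n * (g (2 * n + 1) * q ^+ n / 2).
Proof. by rewrite /mixed_coef big_ord_recr. Qed.

Lemma mixed_coef_neq0 n : mixed_coef n != 0.
Proof.
apply/prodf_neq0 => i _; rewrite addn1.
rewrite mulf_neq0 ?invr_eq0 ?pnatr_eq0 // mulf_neq0 ?qB_gamma_neq0 //.
by rewrite expf_neq0 ?Ctilde_neq0.
Qed.

(** The closed form is propagated from index [2n] to [2n+2] by [qbracketD]
    and from [2n+1] to [2n+3] by [qbracket_exchange].  Moments are always
    brought to the highest one present, by [u_step], so that the induction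
    only compares scalar factors. *)
Lemma mixed_moments n k :
  v ('X^(2 * k) * sym_poly g (2 * n)) =
    mixed_coef n * bracket_prod q n k * moment v (k + n).*2 /\
  v ('X^(2 * k + 1) * sym_poly g (2 * n + 1)) =
    - (g (2 * n + 1) * d (2 * n) / 2) * mixed_coef n
      * bracket_prod q n k * moment v (k + n).+1.*2.
Proof.
have two : (2 : C) != 0 by rewrite pnatr_eq0.
elim: n k => [|n IH] k.
  rewrite /mixed_coef /bracket_prod !big_ord0 !mul1r muln0 addn0.
  rewrite /sym_poly /= mulr1 mul2n -exprSr addn1 /d qbracket0 addr0.
  by split=> //; rewrite /moment; field.
have even k' : v ('X^(2 * k') * sym_poly g (2 * n.+1)) =
    mixed_coef n.+1 * bracket_prod q n.+1 k' * u (k' + n.+1).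
  have -> : (2 * n.+1 = (2 * n).+2)%N by rewrite mulnS.
  have [IHeven IHodd] := IH k'; rewrite !addn1 in IHodd *.
  rewrite mixed_moment_rec IHeven IHodd -!/(u _) (u_step (k' + n)) mixed_coefS.
  rewrite addn1 bracket_prodS addnS.
  have := qbracketD hq k' n; rewrite addnn -mul2n => e.
  have -> : d (k' + n) = d (2 * n) + q ^+ n * (qbracket q k' - qbracket q n).
    by rewrite -e /d; ring.
  by field.
split; first exact: even.
have -> : (2 * n.+1 + 1 = (2 * n + 1).+2)%N by rewrite mulnS.
rewrite mixed_moment_rec.
have -> : ((2 * k + 1).+1 = 2 * k.+1)%N by rewrite mulnS addn1.
have -> : ((2 * n + 1).+1 = 2 * n.+1)%N by rewrite mulnS addn1.
rewrite even (IH k).2.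
have -> : (2 * n.+1 = 2 * n + 2)%N by rewrite mulnS addn2.
rewrite qB_gamma_even.
have -> : ((2 * n + 2).+1 = 2 * n + 3)%N by rewrite -addnS.
rewrite qB_gamma_odd -!/(u _) addSn !(addnS k) (u_step (k + n).+1).
rewrite bracket_prodSS // bracket_prodS mixed_coefS.
have e := qbracket_exchange hq a k n; rewrite -!/(d _) in e.
have d1 : d (2 * n + 1) != 0 := d_neq0 _.
have d2 : d (2 * n) != 0 := d_neq0 _.
have d3 : d (2 * n + 2) != 0 := d_neq0 _.
(* Once [k+1] is eliminated through the exchange identity, the claim holds with
   the remaining brackets treated as independent variables. *)
have -> : qbracket q k.+1 = (q * d n * (qbracket q k - qbracket q n)
    + qbracket q n.+1 * d (k + n).+1) / d (2 * n + 1).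
  by rewrite e; field.
have -> : q ^+ (2 * n) = q ^+ n * q ^+ n by rewrite mul2n -addnn exprD.
by rewrite exprS; field; rewrite d1 d2 d3.
Qed.

Lemma qB_monic_OPS : monic_OPS v (sym_poly g).
Proof.
have two : (2 : C) != 0 by rewrite pnatr_eq0.
apply: monic_OPS_of_mixed_moments; first exact: sym_poly_monic.
  move=> m n mn; case: (boolP (odd (m + n))) => [|e].
    exact: mixed_moment_odd.
  rewrite oddD negb_add in e; move: mn.
  rewrite -[m]odd_double_half -[n]odd_double_half (eqP e).
  rewrite ltn_add2l ltn_double -!mul2n => lt.
  case: (odd n); rewrite ?add0n ?(addnC true) /=.
    by rewrite (mixed_moments _ _).2 bracket_prod_lt // mulr0 mul0r.
  by rewrite (mixed_moments _ _).1 bracket_prod_lt // mulr0 mul0r.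
move=> n; rewrite -[n]odd_double_half -!mul2n.
case: (odd n); rewrite ?add0n ?(addnC true) /=.
  rewrite (mixed_moments _ _).2.
  by rewrite !mulf_neq0 ?oppr_eq0 ?mixed_coef_neq0 ?bracket_prod_neq0
    ?even_moment_neq0 ?mulf_neq0 ?invr_eq0 // ?addn1 ?qB_gamma_neq0 ?d_neq0.
rewrite (mixed_moments _ _).1.
by rewrite !mulf_neq0 ?mixed_coef_neq0 ?bracket_prod_neq0 ?even_moment_neq0.
Qed.

End Coefficients.

(** * The functional equation and the class *)

Section Semiclassical.
Variables (C : numClosedFieldType) (r alpha : C) (v : {scalar {poly C}}).

Lemma Ctilde_root : Ctilde (r ^+ 2) -> Ctilde r.
Proof.
case=> r0 r1; split; first by move: r0; rewrite expf_eq0.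
move=> n /r1; apply: contraNneq => e.
by rewrite -exprM mulnC exprM e expr1n.
Qed.

Hypothesis hr : Ctilde (r ^+ 2).

Let Psi : {poly C} := - ((2 * (r + 1)) *: (alpha *: 'X^2 + 1)).

Lemma Ctilde_addr1 : r + 1 != 0.
Proof.
have := Ctilde_neq1 hr; rewrite -subr_eq0 -(expr1n C 2) subr_sqr.
by rewrite mulf_eq0 negb_or expr1n => /andP[].
Qed.

Lemma qbracket_root n :
  qbracket r n.*2 = (r + 1) * qbracket (r ^+ 2) n.
Proof.
have r1 := Ctilde_subr1 (Ctilde_root hr).
have r2 := Ctilde_subr1 hr.
by rewrite /qbracket -exprM mul2n; field; rewrite r1 r2.
Qed.

Lemma symmetrized_H_equation : symmetrical v ->
    (forall n, (2 * alpha + qbracket (r ^+ 2) n) * moment v n.+1.*2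
               = - (2 * moment v n.*2)) ->
  H_equation r 'X^3 Psi v.
Proof.
move=> sv rec.
have key n : H_form r (poly_mul_form 'X^3 v) 'X^n
    + poly_mul_form Psi v 'X^n =
    - ((2 * (r + 1) * alpha + qbracket r n) * moment v n.+2
       + 2 * (r + 1) * moment v n).
  rewrite /H_form /= /poly_mul_form H_opXn ?(Ctilde_neq1 (Ctilde_root hr)) //.
  rewrite -scalerAr scalarZ.
  have -> : qbracket r n * v ('X^3 * 'X^(n.-1)) = qbracket r n * moment v n.+2.
    case: n => [|n]; last by rewrite -exprD.
    by rewrite qbracket0 !mul0r.
  rewrite /Psi mulNr -scalerAl (mulrDl (_ *: _)) mul1r -scalerAl -exprD.
  rewrite raddfN /= scalarZ.
  by rewrite raddfD /= scalarZ add2n /moment; ring.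
have zero n : H_form r (poly_mul_form 'X^3 v) 'X^n
    + poly_mul_form Psi v 'X^n = 0.
  rewrite key -[n]odd_double_half; case: (odd n).
    by rewrite add1n sv -doubleS sv !mulr0 addr0 oppr0.
  rewrite add0n qbracket_root -doubleS.
  rewrite (_ : _ + _ = (r + 1) *
    ((2 * alpha + qbracket (r ^+ 2) n./2) * moment v n./2.+1.*2
     + 2 * moment v n./2.*2)); last by ring.
  by rewrite rec addNr mulr0 oppr0.
move=> f; rewrite -[f]coefK poly_def !raddf_sum -big_split big1 //= => i _.
by rewrite !scalarZ -mulrDr zero mulr0.
Qed.

Lemma symmetrized_class_condition : class_condition r v 'X^3 Psi.
Proof.
rewrite /class_condition.
have -> : [set c | root 'X^3 c]%classic = [set (0 : C)]%classic.
  apply/seteqP; split=> c /=; first by rewrite rootE hornerXn expf_eq0 => /eqP.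
  by move=> ->; rewrite rootE hornerXn expr0n.
rewrite fsbig_set1 ltr_wpDr // normr_gt0.
rewrite H_opXn ?(Ctilde_neq1 (Ctilde_root hr)) // mulr0 /Psi.
rewrite !hornerE /=.
rewrite ?expr0n /= ?mulr0 ?add0r ?addr0 ?mulr1.
rewrite !mulf_neq0 ?oppr_eq0 ?mulf_neq0 ?pnatr_eq0 ?Ctilde_addr1 //.
exact: Ctilde_neq0 (Ctilde_root hr).
Qed.

Lemma size_symmetrized_Psi : alpha != 0 -> size Psi = 3.
Proof.
move=> a0; rewrite /Psi size_polyN size_scale; last first.
  by rewrite mulf_neq0 ?pnatr_eq0 ?Ctilde_addr1.
by rewrite size_polyDl size_scale // size_polyXn // size_poly1.
Qed.

Lemma symmetrized_class_one : alpha != 0 -> regular v ->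
  H_equation r 'X^3 Psi v -> semiclassical_of_class r v 1.
Proof.
move=> a0 reg eqn; split=> //; first exact: Ctilde_root.
exists 'X^3, Psi; split.
- by split=> //; rewrite ?monicXn ?size_symmetrized_Psi.
- exact: symmetrized_class_condition.
- by rewrite size_symmetrized_Psi // size_polyXn.
Qed.

End Semiclassical.

Theorem mainTheorem4 (R : realType) (q nu : R[i])
    (hq : Ctilde q)
    (hnu : nu != (2 - q) / (q - 1))
    (hnun : forall n : nat, nu != - qbracket q n - 1)
    (B : {scalar {poly R[i]}})
    (hB : is_symmetrized_qBessel nu q B) :
  [/\ semiclassical_of_class (sqrtc q) B 1,
      H_equation (sqrtc q) 'X^3
        (- ((2 * (sqrtc q + 1)) *: (((nu + 1) / 2) *: 'X^2 + 1))) B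
    & let alpha := (nu + 1) / 2 in
      exists gamma : nat -> R[i],
        [/\ recurrence_coefficients B (fun=> 0) gamma,
            gamma 1%N = - alpha^-1,
            (forall n : nat, gamma (2 * n + 2)%N =
               2 * q ^+ (2 * n) * (qbracket q n.+1 /
                 ((2 * alpha + qbracket q (2 * n))
                  * (2 * alpha + qbracket q (2 * n + 1)))))
          & forall n : nat, gamma (2 * n + 3)%N =
               - 2 * q ^+ n.+1 * ((2 * alpha + qbracket q n) /
                 ((2 * alpha + qbracket q (2 * n + 1))
                  * (2 * alpha + qbracket q (2 * n + 2))))]].
Proof.
set alpha := (nu + 1) / 2.
have d_neq0 n : 2 * alpha + qbracket q n != 0.
  rewrite /alpha mulrC divfK ?pnatr_eq0 //; apply: contraNneq (hnun n) => e.
  by rewrite -subr_eq0 -e; apply/eqP; ring.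
have alpha0 : alpha != 0.
  by have := d_neq0 0; rewrite qbracket0 addr0 mulf_eq0 negb_or => /andP[].
case: hB => B_sym [b [/(is_qBessel_moment _ _ (Ctilde_neq1 hq)) [b0 b_rec] Bb]].
have even n : moment B n.*2 = moment b n.
  by rewrite /moment -Bb /sigma_form comp_Xn_poly -exprM mul2n.
have B0 : moment B 0 = 1 by rewrite -double0 even.
have B_rec n : (2 * alpha + qbracket q n) * moment B n.+1.*2
    = - (2 * moment B n.*2) by rewrite !even b_rec.
have ops := qB_monic_OPS hq d_neq0 B_sym B0 B_rec.
have sqr : (sqrtc q) ^+ 2 = q by exact: sqr_sqrtc.
have hr : Ctilde (sqrtc q ^+ 2) by rewrite sqr.
have eqn : H_equation (sqrtc q) 'X^3
    (- ((2 * (sqrtc q + 1)) *: (alpha *: 'X^2 + 1))) B.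
  by apply: symmetrized_H_equation => // n; rewrite sqr.
split=> //.
  apply: symmetrized_class_one eqn => //.
  by split=> //; exists (sym_poly (qB_gamma q (2 * alpha))).
exists (qB_gamma q (2 * alpha)); split.
- by apply: recurrence_coefficients_sym_poly => // n; exact: qB_gamma_neq0.
- by rewrite /=; field.
- exact: qB_gamma_even.
- exact: qB_gamma_odd.
Qed.
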